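(* Let $G\in C^1(\mathbb R^{n+1}\setminus\{0\},\mathbb R^{(n+1)\times(n+1)})$ be a weight matrix and let $\Omega\subset\mathbb R^n$ be a bounded domain. Let $\mathcal H=\mathcal H(x,z)\in C^1(\overline\Omega\times\mathbb R,\mathbb R)$ satisfy $\frac{\partial}{\partial z}\mathcal H\ge 0$ and $$\mathcal H(x,z)^2\ \ge\ \mathrm{tr}(G(p))\,|\nabla\mathcal H(x,z)|\quad\text{for all }x\in\Omega,\ z\in\mathbb R,\ p\in S^n,$$ where $\nabla \mathcal H$ is the full gradient of $\mathcal H$ with respect to $(x,z)\in\mathbb R^{n+1}$. Let $u\in C^3(\Omega,\mathbb R)\cap C^1(\overline\Omega,\mathbb R)$ be such that the graph $X(x)=(x,u(x))$ has prescribed weighted mean curvature $\mathcal H$. Then $$\sup_{\Omega}|\nabla u|\le\sup_{\partial\Omega}|\nabla u| .$$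
   Context: A weight matrix is a map $G=G(p)$ from $\mathbb R^{n+1}\setminus\{0\}$ to the symmetric real $(n+1)\times(n+1)$ matrices such that (i) $\langle G(p)y,y\rangle>0$ for all $p\neq 0$ and all $y\in p^\perp\setminus\{0\}$; (ii) $t\,G(tp)=G(p)$ and $G(p)p=0$ for all $p\ne0$, $t>0$. For an immersion $X$ with unit normal $N$ put $g_{ij}=\langle\partial_iX,\partial_jX\rangle$, $b_{ij}=\langle\partial_{ij}X,N\rangle$, $S=g^{-1}b$, $A_G=(a_{ij})$ with $a_{ij}=\langle G(N)\partial_iX,\partial_jX\rangle$. The weighted mean curvature is $H_G=\mathrm{tr}(g^{-1}A_GS)$. For a graph $X(x)=(x,u(x))$ the upper normal $N=(1+|\nabla u|^2)^{-1/2}(-\nabla u,1)$ is used; the graph has prescribed weighted mean curvature $\mathcal H$ if $H_G(x)=\mathcal H(x,u(x))$ for all $x\in\Omega$. *)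

(* Defs.v *)
From HB Require Import structures.
From mathcomp Require Import all_boot all_order all_algebra.
From mathcomp Require Import all_classical all_reals all_analysis.

Set Implicit Arguments.
Unset Strict Implicit.
Unset Printing Implicit Defensive.

Import Order.TTheory GRing.Theory Num.Theory.
Import numFieldNormedType.Exports.

Local Open Scope classical_set_scope.
Local Open Scope ring_scope.

(* Points of R^n are row vectors.  The library norm on 'rV[R]_n is the maximum
   norm; it is only used for topology, boundedness and differentiation.  The
   lengths |.| of the statement are Euclidean and are written [enorm]. *)

Definition dot (R : realType) (n : nat) (u v : 'rV[R]_n) : R :=
  \sum_(i < n) u 0 i * v 0 i.

Definition enorm (R : realType) (n : nat) (v : 'rV[R]_n) : R :=
  Num.sqrt (dot v v).

(* The column-vector product A v, with vectors stored as rows. *)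
Definition mxapp (R : realType) (m n : nat) (A : 'M[R]_(m, n)) (v : 'rV[R]_n) :
  'rV[R]_m := (A *m v^T)^T.

Definition bvec (R : realType) (n : nat) (i : 'I_n) : 'rV[R]_n := delta_mx 0 i.

Definition partial (R : realType) (n : nat) (V : normedModType R) (i : 'I_n)
  (f : 'rV[R]_n -> V) : 'rV[R]_n -> V := fun x => 'D_(bvec R i) f x.

Definition grad (R : realType) (n : nat) (f : 'rV[R]_n -> R) (x : 'rV[R]_n) :
  'rV[R]_n := \row_i partial i f x.

(* f is of class C^k on the open set U: the partial derivatives of order at
   most k exist and are continuous at every point of U. *)
Fixpoint Ck (R : realType) (n : nat) (V : normedModType R) (k : nat)
    (U : set 'rV[R]_n) (f : 'rV[R]_n -> V) {struct k} : Prop :=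
  (forall x, U x -> {for x, continuous f}) /\
  match k with
  | 0%N => True
  | k'.+1 => forall i : 'I_n,
      (forall x, U x -> derivable f x (bvec R i)) /\ Ck k' U (partial i f)
  end.

(* f is of class C^1 up to the boundary of the open set U: f is C^1 on U,
   continuous on the closure of U, and its gradient on U extends to a continuous
   map Df on the closure of U.  Df is determined by f on the closure of U, and
   is what "grad f" means at boundary points. *)
Definition C1_closure (R : realType) (n : nat) (U : set 'rV[R]_n)
    (f : 'rV[R]_n -> R) (Df : 'rV[R]_n -> 'rV[R]_n) : Prop :=
  [/\ Ck 1 U f,
      {within closure U, continuous f},
      {within closure U, continuous Df} &
      forall x, U x -> Df x = grad f x].

Definition bounded_domain (R : realType) (n : nat) (U : set 'rV[R]_n) : Prop :=
  [/\ open U, connected U, U !=set0 & bounded_set U].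

Definition bdry (T : topologicalType) (A : set T) : set T :=
  closure A `\` interior A.

(* The value G 0 is a junk value, left unconstrained. *)
Definition weight_matrix (R : realType) (m : nat)
    (G : 'rV[R]_m -> 'M[R]_m) : Prop :=
  [/\ forall p, p != 0 -> (G p)^T = G p,
      forall p y, p != 0 -> y != 0 -> dot y p = 0 -> 0 < dot (mxapp (G p) y) y,
      forall (p : 'rV[R]_m) (t : R), p != 0 -> 0 < t -> t *: G (t *: p) = G p &
      forall p, p != 0 -> mxapp (G p) p = 0].

Section WeightedMeanCurvature.
Context (R : realType) (n m : nat).
Variables (G : 'rV[R]_m -> 'M[R]_m) (X N : 'rV[R]_n -> 'rV[R]_m).

Definition first_form (x : 'rV[R]_n) : 'M[R]_n :=
  \matrix_(i, j) dot (partial i X x) (partial j X x).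

Definition second_form (x : 'rV[R]_n) : 'M[R]_n :=
  \matrix_(i, j) dot (partial i (partial j X) x) (N x).

(* [invmx] is the true inverse since the first form of an immersion is
   invertible. *)
Definition shape_matrix (x : 'rV[R]_n) : 'M[R]_n :=
  invmx (first_form x) *m second_form x.

Definition weighted_form (x : 'rV[R]_n) : 'M[R]_n :=
  \matrix_(i, j) dot (mxapp (G (N x)) (partial i X x)) (partial j X x).

Definition weighted_mean_curvature (x : 'rV[R]_n) : R :=
  \tr (invmx (first_form x) *m weighted_form x *m shape_matrix x).

End WeightedMeanCurvature.

Definition pt (R : realType) (n : nat) (x : 'rV[R]_n) (z : R) : 'rV[R]_(n + 1) :=
  row_mx x (const_mx z).

Definition cylinder (R : realType) (n : nat) (U : set 'rV[R]_n) :
  set 'rV[R]_(n + 1) := [set q | U (lsubmx q)].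

Definition graph_map (R : realType) (n : nat) (u : 'rV[R]_n -> R)
  (x : 'rV[R]_n) : 'rV[R]_(n + 1) := pt x (u x).

Definition upper_normal (R : realType) (n : nat) (u : 'rV[R]_n -> R)
  (x : 'rV[R]_n) : 'rV[R]_(n + 1) :=
  (Num.sqrt (1 + enorm (grad u x) ^+ 2))^-1 *: pt (- grad u x) 1.

Definition graph_prescribed_wmc (R : realType) (n : nat)
    (G : 'rV[R]_(n + 1) -> 'M[R]_(n + 1)) (Omega : set 'rV[R]_n)
    (H : 'rV[R]_(n + 1) -> R) (u : 'rV[R]_n -> R) : Prop :=
  forall x, Omega x ->
    weighted_mean_curvature G (graph_map u) (upper_normal u) x = H (pt x (u x)).

(* Main.v *)
Require Import Defs.
From HB Require Import structures.
From mathcomp Require Import all_boot all_order all_algebra.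
From mathcomp Require Import all_classical all_reals all_analysis.
From mathcomp Require Import ring lra.

Set Implicit Arguments.
Unset Strict Implicit.
Unset Printing Implicit Defensive.

Import Order.TTheory GRing.Theory Num.Theory.
Import numFieldNormedType.Exports.

Local Open Scope classical_set_scope.
Local Open Scope ring_scope.

(* On a graph the weighted mean curvature is [tr (A D^2 u)], where [A] is the upper left
   n x n block of [G (q)] and [q = (- grad u, 1)]: the metric [1 + p^T p] cancels because
   [G (q)] annihilates [q].  Differentiating [tr (A D^2 u) = H (x, u)] and contracting with
   [p = grad u] shows that [v = |p|^2 / 2] satisfies
     sum_ij A_ij v_ij + sum_l b_l v_l = tr (A (D^2 u)^2) + <H_x, p> + H_z |p|^2.
   By Cauchy-Schwarz [tr (A (D^2 u)^2) >= H^2 / tr A], and since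
   [tr (G (N)) = W tr (G (q)) >= W tr A] with [W = sqrt (1 + |p|^2)], the hypothesis on [H]
   bounds this below by [W |grad H| >= |p| |grad H|].  Hence the right-hand side is
   nonnegative and the weak maximum principle applies to [v]. *)

(** * Partial derivatives of C^1 and C^2 functions *)

(** The coefficients [b_l] are linear in [D^2 u]: they arise when the derivative falls on [G (q)].
    Only [grad u] is controlled up to the boundary, so the [b_l] need not be bounded there; this is
    what shapes the maximum principle below. Working with the unnormalised [q] instead of the unit
    normal keeps the derivative of [W] out of the computation: the derivatives of [q] are, up to
    sign, the second derivatives of [u]. Contracting with [grad u] then turns each [u_kl] into
    [v_l], and the equation eliminates all third derivatives, so no fourth derivative of [u] ever
    occurs. Positivity of [G (q)] is given only on the orthogonal complement of [q]. Since [q] spans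
    the kernel and has last coordinate 1, no nonzero horizontal vector is in the kernel, which makes
    the block [A] elliptic. Smoothness is given by continuous partial derivatives, whereas the chain
    rule needs total differentiability; the calculus preliminaries bridge the two. *)

Lemma mean_value_symm (R : realType) (g dg : R -> R) (t : R) :
  (forall s : R, `|s| <= `|t| -> is_derive s 1 g (dg s)) ->
  exists2 c, `|c| <= `|t| & g t - g 0 = dg c * t.
Proof.
move=> gd; have gc a b : (forall s, s \in `[a, b] -> `|s| <= `|t|) ->
    {within `[a, b], continuous g}.
  move=> h; apply: derivable_within_continuous => s sab.
  by have [] := gd s (h s sab).
have [t0|t0] := leP 0 t.
- have h s : s \in `[0, t] -> `|s| <= `|t|.
    by rewrite in_itv /= => /andP[s0 st]; rewrite !ger0_norm.
  have [|c ct ->] := @MVT_segment R g dg _ _ t0 _ (gc _ _ h).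
    move=> s st; apply/gd/h; move: st; rewrite !in_itv /=.
    by move=> /andP[/ltW -> /ltW ->].
  by exists c; [exact: h | rewrite subr0].
- have h s : s \in `[t, 0] -> `|s| <= `|t|.
    rewrite in_itv /= => /andP[s0 st]; rewrite !ler0_norm ?lerN2 //.
    exact: ltW.
  have [|c ct E] := @MVT_segment R g dg _ _ (ltW t0) _ (gc _ _ h).
    move=> s st; apply/gd/h; move: st; rewrite !in_itv /=.
    by move=> /andP[/ltW -> /ltW ->].
  by exists c; [exact: h | rewrite -opprB E sub0r mulrN opprK].
Qed.

Lemma is_derive_line (R : realType) (V W : normedModType R) (f : V -> W)
    (y v : V) (s : R) :
  derivable f (y + s *: v) v ->
  is_derive s 1 (fun r => f (y + r *: v)) ('D_v f (y + s *: v)).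
Proof.
have E : (fun h : R => h^-1 *: ((f \o shift (y + s *: v)) (h *: v)
              - f (y + s *: v))) =
         (fun h : R => h^-1 *: (((fun r => f (y + r *: v)) \o shift s) (h *: 1)
              - f (y + s *: v))).
  apply/funext => h /=; congr (_ *: (f _ - _)).
  by rewrite [h *: 1]mulr1 scalerDl addrCA addrC.
move=> fd; split; first by rewrite /derivable -E.
by rewrite /derive -E.
Qed.

Section PartialDerivatives.
Context {R : realType} {n : nat}.
Implicit Types (U : set 'rV[R]_n) (f : 'rV[R]_n -> R) (x y h : 'rV[R]_n).

Lemma norm_coord_le x (i : 'I_n) : `|x 0 i| <= `|x|.
Proof.
rewrite [leRHS]/Num.Def.normr /= mx_normrE.
exact: (le_bigmax _ (fun ij : 'I_1 * 'I_n => `|x ij.1 ij.2|) (0, i)).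
Qed.

Lemma norm_row_le x (c : R) : 0 <= c -> (forall i, `|x 0 i| <= c) -> `|x| <= c.
Proof.
move=> c0 xc; rewrite /Num.Def.normr /= mx_normrE.
by apply: bigmax_le => // -[i j] _ /=; rewrite ord1.
Qed.

Lemma norm_bvec (i : 'I_n) : `|bvec R i| <= 1.
Proof.
apply: norm_row_le => // j; rewrite /bvec mxE eqxx /=.
by case: eqP => _; rewrite ?normr1 ?normr0.
Qed.

Lemma row_sum_bvec h : h = \sum_i h 0 i *: bvec R i.
Proof. by rewrite {1}(row_sum_delta h). Qed.

Lemma partial_mean_value f x (i : 'I_n) (t : R) :
  (forall s, `|s| <= `|t| -> derivable f (x + s *: bvec R i) (bvec R i)) ->
  exists2 c, `|c| <= `|t| &
    f (x + t *: bvec R i) - f x = partial i f (x + c *: bvec R i) * t.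
Proof.
move=> fd; pose g (s : R) := f (x + s *: bvec R i).
have := @mean_value_symm R g (fun s => partial i f (x + s *: bvec R i)) t.
rewrite /g scale0r addr0; apply => s /fd; exact: is_derive_line.
Qed.

(** The increment [h] is added one coordinate at a time: [hk k] keeps its first [k] coordinates.
    Each step is a mean value along a coordinate direction and contributes an error of at most
    [e * |h|]. For the maximum norm the truncations and the intermediate points stay within [|h|] of
    [x]. *)
Lemma C1_remainder_le U f x (d e : R) h :
  Ck 1 U f -> 0 <= e -> `|h| < d ->
  (forall y, `|y - x| < d -> U y) ->
  (forall i y, `|y - x| < d -> `|partial i f y - partial i f x| <= e) ->
  `|f (x + h) - f x - \sum_i h 0 i * partial i f x| <= n%:R * e * `|h|.
Proof.
move=> [_ fC] e0 hd dU de.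
pose hk (k : nat) : 'rV[R]_n := \row_i (if (i < k)%N then h 0 i else 0).
have hkE k (lk : (k < n)%N) :
    hk k.+1 = hk k + h 0 (Ordinal lk) *: bvec R (Ordinal lk).
  apply/rowP => i; rewrite !mxE /= ltnS.
  case: (ltngtP i k) => ik.
  - by rewrite -val_eqE /= (ltn_eqF ik) mulr0 addr0.
  - by rewrite -val_eqE /= (gtn_eqF ik) mulr0 addr0.
  - have -> : i = Ordinal lk by exact: val_inj.
    by rewrite eqxx mulr1 add0r.
have hkl k (c : R) (lk : (k < n)%N) : `|c| <= `|h 0 (Ordinal lk)| ->
    `|hk k + c *: bvec R (Ordinal lk)| <= `|h|.
  move=> ch; apply: norm_row_le => // i; rewrite !mxE /=.
  case: (ltngtP i k) => ik.
  - by rewrite -val_eqE /= (ltn_eqF ik) mulr0 addr0 norm_coord_le.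
  - by rewrite -val_eqE /= (gtn_eqF ik) mulr0 addr0 normr0.
  - have -> : i = Ordinal lk by exact: val_inj.
    by rewrite eqxx mulr1 add0r (le_trans ch) // norm_coord_le.
have main k : (k <= n)%N ->
    `|f (x + hk k) - f x - \sum_(i < n | (i < k)%N) h 0 i * partial i f x|
      <= k%:R * e * `|h|.
  elim: k => [_|k IH lk].
    rewrite (_ : hk 0%N = 0); last by apply/rowP => i; rewrite !mxE.
    by rewrite addr0 subrr big_pred0 // subr0 normr0 !mul0r.
  have /IH {}IH : (k <= n)%N by exact: ltnW.
  rewrite (bigD1 (Ordinal lk)) //=.
  rewrite (eq_bigl (fun i : 'I_n => (i < k)%N)); last first.
    by move=> i; rewrite -val_eqE /= ltnS leq_eqVlt; case: ltngtP.
  have [|c ct E] := @partial_mean_value f (x + hk k) (Ordinal lk)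
      (h 0 (Ordinal lk)).
    move=> s sh; have [+ _] := fC (Ordinal lk); apply.
    by apply: dU; rewrite addrC !addrA addNr add0r (le_lt_trans (hkl _ _ _ sh)).
  rewrite hkE addrA.
  set S := \sum_(i < n | _) _ in IH *; set p := partial _ f x.
  set a := h 0 _ in ct E *.
  rewrite (_ : _ - _ - _ = (f (x + hk k) - f x - S) +
    (f (x + hk k + a *: bvec R (Ordinal lk)) - f (x + hk k) - a * p)); last by ring.
  rewrite E (_ : k.+1%:R * e * `|h| = k%:R * e * `|h| + e * `|h|); last first.
    by rewrite -natr1; ring.
  rewrite (le_trans (ler_normD _ _)) // lerD // [a * p]mulrC -mulrBl normrM.
  rewrite ler_pM // ?norm_coord_le //; apply: de.
  by rewrite addrC !addrA addNr add0r (le_lt_trans (hkl _ _ _ ct)).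
have := main n (leqnn n).
rewrite (_ : hk n = h); last by apply/rowP => i; rewrite !mxE ltn_ord.
by rewrite (eq_bigl xpredT) // => i; rewrite ltn_ord.
Qed.

Lemma nbhs_normP (x : 'rV[R]_n) (P : set 'rV[R]_n) :
  nbhs x P <-> exists2 d : R, 0 < d & forall y, `|y - x| < d -> P y.
Proof.
split=> [/nbhs_ballP[d d0 dP]|[d d0 dP]].
  by exists d => // y yd; apply: dP; rewrite -ball_normE /= distrC.
by apply/nbhs_ballP; exists d => // y; rewrite -ball_normE /= distrC => /dP.
Qed.

Lemma C1_differentiable U f x :
  open U -> Ck 1 U f -> U x -> differentiable f x.
Proof.
move=> oU fC Ux.
pose L h := \sum_i h 0 i * partial i f x.
have Llin : linear L.
  move=> a y z; rewrite /L scaler_sumr -big_split; apply: eq_bigr => i _ /=.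
  by rewrite !mxE mulrDl -scalerAl.
pose LM := GRing.isLinear.Build _ _ _ _ _ Llin.
pose LL : {linear 'rV[R]_n -> R} := HB.pack L LM.
have Lc : continuous LL.
  move=> y; apply: differentiable_continuous.
  rewrite (_ : LL = \sum_i (fun h => h 0 i * partial i f x) :> (_ -> _)); last first.
    by apply/funext => h; rewrite fct_sumE.
  apply: differentiable_sum => i; apply: differentiableM => //.
  exact: differentiable_coord.
have fL : (f : 'rV[R]_n -> R^o) \o shift x =
    cst (f x : R^o) + (LL : 'rV[R]_n -> R^o) +o_ (0 : 'rV[R]_n) id.
  apply/eqaddoP => _/posnumP[e].
  (* The remainder estimate multiplies the oscillation by [n]; dividing by [n + 1] absorbs this
     factor and stays meaningful for [n = 0]. *)
  have e0 : 0 < e%:num / n.+1%:R by rewrite divr_gt0.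
  have : nbhs x (U `&` [set y | forall i,
      `|partial i f y - partial i f x| <= e%:num / n.+1%:R]).
    apply: filterI; first exact: open_nbhs_nbhs.
    apply: (@filter_forall _ _ (fun i y =>
      `|partial i f y - partial i f x| <= e%:num / n.+1%:R) (nbhs x) (nbhs_filter x)) => i.
    have [_ [fc _]] := (fC.2 i).
    have /cvgrPdist_le /(_ _ e0) := fc _ Ux.
    by apply: filterS => y; rewrite distrC.
  move=> /nbhs_normP [d d0 dP].
  apply/nbhs_normP; exists d => // h; rewrite subr0 => hd /=.
  rewrite -![(_ + _ : _ -> _) _]/(_ + _) -![(- _ : _ -> _) _]/(- _).
  rewrite -![(_ + _ : _ -> _) _]/(_ + _) /= [h + x]addrC opprD addrA.
  apply: le_trans (C1_remainder_le fC (ltW e0) hd _ _) _.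
  - by move=> y /dP[].
  - by move=> i y /dP[_ /(_ i)].
  - rewrite ler_wpM2r // mulrCA ler_piMr // ler_pdivrMr // mul1r ler_nat.
    exact: leqnSn.
apply/diff_locallyP; rewrite (diff_unique Lc fL); split => //.
Qed.

Lemma diff_partialE f x h : differentiable f x ->
  'D_h f x = \sum_i h 0 i * partial i f x.
Proof.
move=> fd; rewrite deriveE // {1}(row_sum_bvec h) linear_sum.
by apply: eq_bigr => i _; rewrite linearZ /partial deriveE.
Qed.

(** Two mean values: one along [e_i] for the difference of [f] between two parallel segments, one
    along [e_j] for [partial i f]. Two moves of length at most [t] leave [x] by at most [2 * t],
    hence the condition on [d]. *)
Lemma second_difference U f x (i j : 'I_n) (t d : R) :
  Ck 2 U f -> 0 <= t -> 2 * t < d -> (forall y, `|y - x| < d -> U y) ->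
  exists2 y, `|y - x| < d &
    f (x + t *: bvec R i + t *: bvec R j) - f (x + t *: bvec R i) -
    (f (x + t *: bvec R j) - f x) = partial j (partial i f) y * t * t.
Proof.
move=> [_ fC] t0 td dU.
have bnd (a b : R) : `|a| <= `|t| -> `|b| <= `|t| ->
    `|x + a *: bvec R i + b *: bvec R j - x| < d.
  move=> at_ bt; rewrite addrC !addrA addNr add0r; apply: le_lt_trans td.
  rewrite (le_trans (ler_normD _ _)) // mulr2n mulrDl mul1r !normrZ.
  rewrite (ger0_norm t0) in at_ bt.
  by rewrite lerD // -[leRHS]mulr1 ler_pM ?norm_bvec.
have dv a b : `|a| <= `|t| -> `|b| <= `|t| ->
    derivable f (x + a *: bvec R i + b *: bvec R j) (bvec R i).
  by move=> *; apply: (fC i).1; exact/dU/bnd.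
pose g s := f (x + t *: bvec R j + s *: bvec R i) - f (x + s *: bvec R i).
have [s st|c ct] := @mean_value_symm R g
   (fun s => partial i f (x + t *: bvec R j + s *: bvec R i) -
             partial i f (x + s *: bvec R i)) t.
  apply: is_deriveB; apply: is_derive_line.
    by rewrite addrAC; exact: dv.
  by have := dv s 0; rewrite scale0r addr0; apply; rewrite ?normr0.
rewrite /g scale0r !addr0 [x + _ + _]addrAC => E.
have [|e et E2] := @partial_mean_value (partial i f) (x + c *: bvec R i) j t.
  by move=> s st; have [_ [_ /(_ j) [+ _]]] := fC i; apply; exact/dU/bnd.
exists (x + c *: bvec R i + e *: bvec R j); first exact: bnd.
by rewrite -E2 (addrAC x (c *: _)) -E.
Qed.

(** The second difference is symmetric in [i] and [j], so the two mixed derivatives agree at some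
    pair of points near [x]; their continuity brings both points back to [x]. *)
Lemma partialC U f x (i j : 'I_n) : open U -> Ck 2 U f -> U x ->
  partial i (partial j f) x = partial j (partial i f) x.
Proof.
move=> oU fC Ux; apply/eqP; rewrite -subr_eq0 -normr_le0.
apply/ler_addgt0Pr => e e0; rewrite add0r.
have e2 : 0 < e / 2 by rewrite divr_gt0.
have cont k l : \forall y \near x,
    `|partial k (partial l f) x - partial k (partial l f) y| <= e / 2.
  have [_ [_ /(_ k) [_ [fc _]]]] := fC.2 l.
  by have /cvgrPdist_le := fc _ Ux; apply.
have : nbhs x (U `&` ([set y |
    `|partial i (partial j f) x - partial i (partial j f) y| <= e / 2] `&` [set y |
    `|partial j (partial i f) x - partial j (partial i f) y| <= e / 2])).
  apply: filterI; [exact: open_nbhs_nbhs | exact: filterI (cont _ _) (cont _ _)].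
move=> /nbhs_normP[d d0 dP].
have dU y : `|y - x| < d -> U y by move=> /dP[].
pose t := d / 3; have t0 : 0 < t by rewrite divr_gt0.
have td : 2 * t < d by rewrite /t; lra.
have [y /dP[_ [_ y1]] E1] := second_difference i j fC (ltW t0) td dU.
have [z /dP[_ [z1 _]] E2] := second_difference j i fC (ltW t0) td dU.
have /mulIf tt : t != 0 by rewrite gt_eqF.
have yz : partial j (partial i f) y = partial i (partial j f) z.
  apply/tt/tt; apply: etrans (esym E1) _; apply: etrans E2.
  rewrite (addrAC x (t *: bvec R j)) !opprB [LHS]addrACA [RHS]addrACA.
  by congr (_ + _); exact: addrC.
rewrite -(subrKA (partial i (partial j f) z)) -[X in _ + (X - _)]yz.
apply: le_trans (ler_normD _ _) _; rewrite [leRHS]splitr; apply: lerD.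
  exact: z1.
by rewrite distrC; exact: y1.
Qed.

End PartialDerivatives.

(** * Second-order conditions at a local maximum *)

(** If [l > 0], then [h1], which vanishes at 0, is positive just to the right of 0, and the mean
    value theorem makes [h] exceed [h 0] there. *)
Lemma local_max_derive2_le0 (R : realType) (h h1 : R -> R) (l : R) :
  (\forall t \near (0 : R), is_derive (t : R) 1 h (h1 t)) ->
  is_derive (0 : R) 1 h1 l ->
  (\forall t \near (0 : R), h t <= h 0) ->
  h1 0 = 0 /\ l <= 0.
Proof.
move=> dh dh1 hmax.
have /nbhs_ballP[d d0 dP] : nbhs (0 : R)
    ([set t : R | is_derive (t : R) 1 h (h1 t)] `&` [set t : R | h t <= h 0]).
  exact: filterI.
have {}dP t : `|t| < d -> is_derive (t : R) 1 h (h1 t) /\ h t <= h 0.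
  by move=> td; apply: dP; rewrite -ball_normE /= sub0r normrN.
have h10 : h1 0 = 0.
  have h0 : (0 : R) \in `]-d, d[ by rewrite in_itv /= oppr_lt0 d0.
  have inb t : t \in `]-d, d[ -> `|t| < d.
    by rewrite in_itv /= ltr_norml.
  have gtN : - d <= d by apply: (@le_trans _ _ 0); rewrite ?oppr_le0 ltW.
  have [||_ D0] := @derive1_at_max R h (-d) d 0 gtN _ h0.
  - by move=> t /inb /dP[[]].
  - by move=> t /inb /dP[].
  by have [[_ <-] _] := dP 0 (inb _ h0); exact: D0.
split=> //; rewrite leNgt; apply/negP => l0.
have cv : (fun s : R => s^-1 *: ((h1 \o shift 0) (s *: 1) - h1 0)) @ 0^' --> l.
  by have [dv <-] := dh1; exact: dv.
have /cvgrPdist_lt /(_ l l0) := cv; rewrite near_withinE.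
move=> /nbhs_ballP[e e0 eP].
pose t := Num.min (d / 2) (e / 2).
have t0 : 0 < t by rewrite lt_min !divr_gt0.
have td : t < d by rewrite gt_min ltr_pdivrMr // ltr_pMr // ltr1n.
have te : t < e by rewrite gt_min orbC ltr_pdivrMr // ltr_pMr // ltr1n.
have [||c] := @MVT R h h1 0 t t0.
- move=> s; rewrite in_itv /= => /andP[s0 st].
  by apply: (dP s _).1; rewrite gtr0_norm // (lt_trans st).
- apply: derivable_within_continuous => s; rewrite in_itv /= => /andP[s0 st].
  by have [|[]] := dP s; rewrite ?ger0_norm // (le_lt_trans st).
rewrite in_itv /= => /andP[c0 ct] E.
have := eP c; rewrite -ball_normE /= sub0r normrN gtr0_norm // (lt_trans ct) //.
move=> /(_ isT); rewrite gt_eqF // => /(_ isT).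
rewrite h10 subr0 addr0 [c *: 1]mulr1 [_ *: _]/(_ * _) ltr_distlC => /andP[+ _].
rewrite subrr pmulr_rgt0 ?invr_gt0 // => h1c.
have := (dP t _).2; rewrite gtr0_norm // => /(_ td); apply/negP; rewrite -ltNge.
by rewrite -subr_gt0 E subr0 mulr_gt0.
Qed.

(** The one-variable test is applied on each line [x + t *: z], where [W] is the directional
    derivative of [w]. The gradient vanishes by taking for [z] the basis vectors. *)
Lemma local_max_hessian (R : realType) (n : nat) (w : 'rV[R]_n -> R)
    (dw : 'I_n -> 'rV[R]_n -> R) (x : 'rV[R]_n) :
  (\forall y \near x, differentiable w y /\ forall i, partial i w y = dw i y) ->
  (forall i, differentiable (dw i) x) ->
  (\forall y \near x, w y <= w x) ->
  (forall i, dw i x = 0) /\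
  forall z : 'rV[R]_n, \sum_i \sum_j z 0 i * z 0 j * partial j (dw i) x <= 0.
Proof.
move=> wdw ddw wmax.
have lin (z : 'rV[R]_n) : \sum_i z 0 i * dw i x = 0 /\
    \sum_i \sum_j z 0 i * z 0 j * partial j (dw i) x <= 0.
  pose W := \sum_i (fun y => z 0 i * dw i y).
  have dW : differentiable W x.
    by apply: differentiable_sum => i; apply: differentiableM.
  have line_cvg : (fun t : R => x + t *: z) @ (0 : R) --> x.
    have : (fun t : R => x + t *: z) @ (0 : R) --> x + 0 *: z.
      by apply: cvgD; [exact: cvg_cst | exact: cvgZr_tmp].
    by rewrite scale0r addr0.
  have := @local_max_derive2_le0 R (fun t => w (x + t *: z))
    (fun t => W (x + t *: z)) ('D_z W x).
  rewrite /= scale0r addr0 => -[|||].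
  - move: (line_cvg _ wdw); apply: (@filterS _ (nbhs (0 : R)) _) => t /= [dwt pwt].
    have := is_derive_line (diff_derivable dwt).
    rewrite diff_partialE // /W fct_sumE.
    by under eq_bigr do rewrite pwt.
  - have := @is_derive_line R _ _ W x z 0; rewrite scale0r addr0; apply.
    exact: diff_derivable.
  - exact: line_cvg _ wmax.
  rewrite {1}/W fct_sumE => W0 H; split => //; move: H.
  rewrite /W derive_sum; last first.
    by move=> i; apply: diff_derivable; apply: differentiableM.
  rewrite (eq_bigr (fun i => \sum_j z 0 i * z 0 j * partial j (dw i) x)) // => i _.
  rewrite deriveMl; last exact: diff_derivable.
  by rewrite diff_partialE // mulr_sumr; apply: eq_bigr => j _; rewrite mulrA.
split=> [i|z]; last exact: (lin z).2.
rewrite -[RHS](lin (bvec R i)).1 (bigD1 i) //= big1 ?addr0 => [|j ji].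
  by rewrite mxE !eqxx mul1r.
by rewrite mxE (negPf ji) mul0r.
Qed.

(** * Trace inequalities for positive semidefinite matrices *)

Section TraceInequalities.
Context {R : realFieldType} {n : nat}.
Implicit Types A B S : 'M[R]_n.

Definition psd A := forall y : 'rV[R]_n, 0 <= (y *m A *m y^T) 0 0.

Lemma formE A (y z : 'rV[R]_n) :
  (y *m A *m z^T) 0 0 = \sum_i \sum_j y 0 i * z 0 j * A i j.
Proof.
rewrite mxE exchange_big /=; apply: eq_bigr => j _; rewrite mxE mulr_suml.
by apply: eq_bigr => i _; rewrite mxE; ring.
Qed.

Lemma form_delta A i j :
  ((delta_mx 0 i : 'rV[R]_n) *m A *m (delta_mx 0 j : 'rV[R]_n)^T) 0 0 = A i j.
Proof. by rewrite trmx_delta -rowE -colE !mxE. Qed.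

Lemma form_sym A (y z : 'rV[R]_n) : A^T = A ->
  (y *m A *m z^T) 0 0 = (z *m A *m y^T) 0 0.
Proof.
move=> As.
have -> : (z *m A *m y^T) 0 0 = (z *m A *m y^T)^T 0 0 by rewrite [RHS]mxE.
by rewrite !trmx_mul trmxK As mulmxA.
Qed.

Lemma psd_diag_ge0 A i : psd A -> 0 <= A i i.
Proof. by move=> /(_ (delta_mx 0 i)); rewrite form_delta. Qed.

Lemma formDZ A (y z : 'rV[R]_n) (t : R) : A^T = A ->
  ((y + t *: z) *m A *m (y + t *: z)^T) 0 0 =
  (y *m A *m y^T) 0 0 + 2 * t * (y *m A *m z^T) 0 0 + t ^+ 2 * (z *m A *m z^T) 0 0.
Proof.
move=> As; rewrite linearD /= linearZ /= !mulmxDl !mulmxDr -!scalemxAl -!scalemxAr.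
rewrite !mxE [X in _ + (t * X + _)](_ : _ = (y *m A *m z^T) 0 0).
  by rewrite !mxE; ring.
by rewrite (form_sym y z As) !mxE.
Qed.

Lemma psd_diag_eq0 A i j : A^T = A -> psd A -> A i i = 0 -> A i j = 0.
Proof.
move=> As Ap Aii.
(* With [A i i = 0] the form at [e_j + t e_i] is affine in [t]; were [A j i] nonzero, this [t] would
   give the value [- A j j - 2 < 0]. *)
have := Ap ((delta_mx 0 j : 'rV[R]_n) + (- (A j j + 1) / A j i) *: (delta_mx 0 i : 'rV[R]_n)).
rewrite formDZ // !form_delta Aii mulr0 addr0.
have -> : A i j = A j i by rewrite -[in LHS]As mxE.
have [//|Aji] := eqVneq (A j i) 0.
rewrite (_ : _ + _ = - A j j - 2); last by field.
have := psd_diag_ge0 j Ap; lra.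
Qed.

(* Induction on the number of nonzero rows: a Cholesky step subtracts a rank one matrix. *)
Lemma psd_trace_le0 A B : A^T = A -> psd A -> psd (- B) ->
  \sum_i \sum_j A i j * B i j <= 0.
Proof.
move=> As Ap Bn.
have [k] : exists k : nat, forall i j : 'I_n, (k <= i)%N -> A i j = 0.
  by exists n => i j; rewrite leqNgt ltn_ord.
elim: k A As Ap => [|k IH] A As Ap Ak.
  by rewrite big1 // => i _; rewrite big1 // => j _; rewrite Ak ?mul0r.
have [kn|nk] := ltnP k n; last first.
  apply: IH => // i j ki; have := leq_trans (ltn_ord i) (leq_trans nk ki).
    by rewrite ltnn.
pose k0 := Ordinal kn; pose a := A k0 k0.
have Aji i j : A i j = A j i by rewrite -[in LHS]As mxE.
have [a0|aN0] := eqVneq a 0.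
  apply: IH => // i j; rewrite leq_eqVlt => /orP[/eqP ki|]; last exact: Ak.
  have -> : i = k0 by exact: val_inj.
  exact: psd_diag_eq0.
have a_gt0 : 0 < a by rewrite lt_neqAle eq_sym aN0 psd_diag_ge0.
pose c := row k0 A.
have cE j : c 0 j = A k0 j by rewrite mxE.
pose A' := A - a^-1 *: (c^T *m c).
have A'E i j : A' i j = A i j - a^-1 * (A k0 i * A k0 j).
  by rewrite !mxE big_ord1 !mxE.
have -> : \sum_i \sum_j A i j * B i j =
    \sum_i \sum_j A' i j * B i j + a^-1 * (c *m B *m c^T) 0 0.
  rewrite formE mulr_sumr -big_split; apply: eq_bigr => i _ /=.
  rewrite mulr_sumr -big_split; apply: eq_bigr => j _ /=.
  by rewrite A'E !cE; ring.
have cB : (c *m B *m c^T) 0 0 <= 0.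
  by have := Bn c; rewrite mulmxN mulNmx mxE oppr_ge0.
rewrite -[leRHS]addr0 lerD //; last by rewrite mulr_ge0_le0 // invr_ge0 ltW.
apply: IH.
- by apply/matrixP => i j; rewrite mxE !A'E Aji [A k0 j * _]mulrC.
- move=> y; pose s := (y *m A *m (delta_mx 0 k0 : 'rV[R]_n)^T) 0 0.
  have yc : (y *m c^T) 0 0 = s.
    rewrite /s -[in RHS]As -mulmxA -trmx_mul -rowE //.
  have cy : (c *m y^T) 0 0 = s.
    by rewrite -yc !mxE; apply: eq_bigr => i _; rewrite !mxE mulrC.
  (* Completing the square: [t = - s / a] minimises the form of [A] at [y + t e_k0], and the minimum
     is the form of [A'] at [y]. *)
  have := Ap (y + (- s / a) *: (delta_mx 0 k0 : 'rV[R]_n)).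
  rewrite formDZ // form_delta -/s -/a; congr (0 <= _).
  rewrite /A' mulmxBr mulmxBl -scalemxAr -scalemxAl !mulmxA.
  rewrite -[y *m c^T *m c *m _]mulmxA.
  set M := y *m A *m y^T; set P := y *m c^T in yc *; set Q := c *m y^T in cy *.
  rewrite !mxE big_ord1 yc cy.
  by field.
- move=> i j; rewrite leq_eqVlt A'E => /orP[/eqP ki|ki].
    have -> : i = k0 by exact: val_inj.
    by rewrite -/a; field.
  by rewrite Ak // Aji Ak // mul0r mulr0 subr0.
Qed.

(* Nonnegativity of [\tr (A *m (S - c) *m (S - c)^T)] at its minimum [c]. *)
Lemma psd_trace_sqr_le A S : psd A -> S^T = S -> 0 < \tr A ->
  (\tr (A *m S)) ^+ 2 <= \tr A * \tr (S *m A *m S).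
Proof.
move=> Ap Ss tA; pose c := \tr (A *m S) / \tr A; pose T := S - c%:M.
have : 0 <= \tr (T *m A *m T^T).
  rewrite /mxtrace sumr_ge0 // => i _.
  have -> : (T *m A *m T^T) i i = (row i T *m A *m (row i T)^T) 0 0.
    by rewrite -row_mul [LHS]mxE [RHS]mxE; apply: eq_bigr => j _; rewrite !mxE.
  exact: Ap.
have -> : T^T = T by rewrite /T linearB /= Ss tr_scalar_mx.
rewrite /T mulmxBr !mulmxBl !mul_scalar_mx !mul_mx_scalar !linearB /= !linearZ /=.
have -> : \tr (S *m A) = \tr (A *m S) by rewrite mxtrace_mulC.
rewrite -scalemxAl linearZ /=.
rewrite (_ : _ - _ + _ = \tr (S *m A *m S) - \tr (A *m S) ^+ 2 / \tr A); last first.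
  by rewrite /c /GRing.scale /=; field; rewrite gt_eqF.
by rewrite subr_ge0 ler_pdivrMr // mulrC.
Qed.

End TraceInequalities.

(** * Weak maximum principle *)

Lemma bounded_closure (R : realType) (V : normedModType R) (A : set V) :
  bounded_set A -> bounded_set (closure A).
Proof.
move=> [M [Mr AM]]; exists M; split => // r Mr'.
have cl : closed [set x : V | `|x| <= r].
  have /continuous_closedP nc : continuous (fun x : V => `|x| : R^o).
    exact: norm_continuous.
  exact: (nc _ (@closed_le R r)).
have Ar : A `<=` [set x : V | `|x| <= r] by move=> x /(AM r Mr').
by move=> x /(closureS Ar); rewrite -((closure_id _).1 cl).
Qed.

Section ExponentialBarrier.
Context {R : realType} {n : nat}.
Variables (g : R) (i0 : 'I_n).

Definition exp_coord (y : 'rV[R]_n) : R := expR (g * y 0 i0).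

Lemma derive_coord (y h : 'rV[R]_n) : 'D_h (fun z : 'rV[R]_n => z 0 i0) y = h 0 i0.
Proof.
have := derive_mx (@derivable_id _ _ y h); rewrite derive_id.
by move=> /matrixP/(_ 0 i0) ->; rewrite mxE.
Qed.

Lemma differentiable_exp_coord y : differentiable exp_coord y.
Proof.
apply: (@differentiable_comp _ _ _ _ (fun z : 'rV[R]_n => g * z 0 i0) (@expR R)).
  by apply: differentiableM => //; exact: differentiable_coord || by [].
exact/derivable1_diffP/derivable_expR.
Qed.

Lemma partial_exp_coord i y :
  partial i exp_coord y = g * (i == i0)%:R * exp_coord y.
Proof.
pose L := fun z : 'rV[R]_n => g * z 0 i0.
have dL : differentiable L y.
  by apply: differentiableM => //; exact: differentiable_coord || by [].
have dE : differentiable (@expR R) (L y) by exact/derivable1_diffP/derivable_expR.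
rewrite /partial (_ : exp_coord = @expR R \o L) // deriveE; last exact: differentiable_comp.
rewrite diff_comp //= diff1E // -deriveE // derive1E derive_val.
rewrite /L deriveMl; last exact/diff_derivable/differentiable_coord.
by rewrite derive_coord mxE eqxx /= eq_sym.
Qed.

End ExponentialBarrier.

(* [b] may blow up at the boundary, so the barrier [e * exp (g * y_i0)] is tuned on
   the compact superlevel set [K], which avoids the boundary. *)
Lemma weak_maximum_principle (R : realType) (n : nat) (i0 : 'I_n)
    (U : set 'rV[R]_n) (v phi : 'rV[R]_n -> R) (dv : 'I_n -> 'rV[R]_n -> R)
    (a : 'rV[R]_n -> 'M[R]_n) (b : 'I_n -> 'rV[R]_n -> R) (c : R) (x1 : 'rV[R]_n) :
  open U -> bounded_set U -> {within closure U, continuous phi} ->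
  (forall x, U x -> phi x = v x) ->
  (forall x, U x -> differentiable v x) ->
  (forall x i, U x -> partial i v x = dv i x) ->
  (forall x i, U x -> differentiable (dv i) x) ->
  (forall x, U x -> (a x)^T = a x) -> (forall x, U x -> psd (a x)) ->
  (forall x, U x -> 0 < a x i0 i0) ->
  (forall x, U x -> {for x, continuous (fun y => a y i0 i0)}) ->
  (forall x, U x -> {for x, continuous (b i0)}) ->
  (forall x, U x -> 0 <= \sum_i \sum_j a x i j * partial j (dv i) x
     + \sum_i b i x * dv i x) ->
  U x1 -> c < v x1 -> exists2 y, bdry U y & c < phi y.
Proof.
move=> oU bU phic phiv diffv pv ddv asym apsd agt0 ac bc Lv Ux1 cx1.
apply: contrapT => noy; have phi_bd y : bdry U y -> phi y <= c.
  by move=> yb; rewrite leNgt; apply/negP => cy; apply: noy; exists y.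
(* A level strictly between the boundary bound [c] and [v x1]: the superlevel set at [c'] then
   contains [x1] and misses the boundary. *)
pose c' := (c + v x1) / 2.
have cc' : c < c' by rewrite /c'; lra.
have c'x1 : c' < v x1 by rewrite /c'; lra.
pose K := closure U `&` [set y | c' <= phi y].
have KU : K `<=` U.
  move=> y [cly /= c'y]; apply: contrapT => nUy.
  have /phi_bd : bdry U y by split => //; rewrite (interior_id U).1.
  by rewrite leNgt (lt_le_trans cc').
have Kx1 : K x1.
  by split; [exact: subset_closure | rewrite /= phiv // ltW].
have Kcpt : compact K.
  have /continuous_closedP/(_ _ (@closed_ge R c'))/closed_subspaceP[V cV VU] := phic.
  have -> : K = closure U `&` V.
    by rewrite [RHS]setIC VU /K setIC.
  apply: bounded_closed_compact; last exact: closedI (@closed_closure _ U) cV.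
  have [M [Mr AM]] := bounded_closure bU.
  by exists M; split => // r /AM Ar y [] /Ar.
have Kne : K !=set0 by exists x1.
have Kc (f : 'rV[R]_n -> R) : (forall x, U x -> {for x, continuous f}) -> {within K, continuous f}.
  by move=> fc; apply: continuous_in_subspaceT => x /set_mem /KU /fc.
have [xr _ rmax] := compact_EVT_max (R := R) (f := fun x => - b i0 x / a x i0 i0)
  Kne Kcpt (Kc _ (fun x Ux => cvgM (cvgN (bc x Ux)) (cvgV (lt0r_neq0 (agt0 x Ux)) (ac x Ux)))).
(* The rate dominates [- b / a] on [K], and the added 1 makes the inequality strict. It gives
   [a E_ii + b E_i = g E (g a + b) > 0] for the barrier [E], with [i = i0]. *)
pose g := `|- b i0 xr / a xr i0 i0| + 1.
have g0 : 0 < g by rewrite ltr_wpDl.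
have gP x : K x -> 0 < b i0 x + g * a x i0 i0.
  move=> Kx; have /rmax H : x \in K by exact: mem_set.
  rewrite -ltrBlDl sub0r -ltr_pdivrMr ?agt0 //; last exact: KU.
  by rewrite (le_lt_trans H) // (le_lt_trans (ler_norm _)) // ltrDl.
pose E := exp_coord g i0.
have Ec x : {for x, continuous E}.
  exact/differentiable_continuous/differentiable_exp_coord.
have E0 x : 0 < E x by exact: expR_gt0.
have [xB _ Bmax] := compact_EVT_max Kne Kcpt (Kc _ (fun x _ => Ec x)).
(* The perturbation [e * E] is at most half the gap [v x1 - c'] on [K], so a maximum point of [w]
   over [K] still has [v > c']. *)
pose e := (v x1 - c') / (2 * E xB).
have e0 : 0 < e by rewrite divr_gt0 ?subr_gt0 // mulr_gt0.
pose w x := v x + e * E x.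
have diffw x : U x -> differentiable w x.
  move=> Ux; apply: differentiableD; first exact: diffv.
  by apply: differentiableM => //; exact: differentiable_exp_coord.
have [x0 /set_mem Kx0 wmax] := compact_EVT_max Kne Kcpt
  (Kc _ (fun x Ux => differentiable_continuous (diffw x Ux))).
have Ux0 := KU _ Kx0.
have vx0 : c' < v x0.
  have := wmax _ (mem_set Kx1); rewrite /w => H.
  have Ex0 : e * E x0 <= e * E xB by rewrite ler_pM2l // Bmax // mem_set.
  have Ex1 : 0 < e * E x1 by rewrite mulr_gt0.
  have eB : e * E xB = (v x1 - c') / 2.
    by rewrite /e; field; rewrite gt_eqF.
  lra.
have nU : \forall y \near x0, U y by exact: open_nbhs_nbhs.
pose dw i y := dv i y + e * (g * (i == i0)%:R * E y).
have wdw i y : U y -> partial i w y = dw i y.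
  move=> Uy; rewrite /partial deriveD; last 2 first.
  - exact/diff_derivable/diffv.
  - apply: diff_derivable; apply: differentiableM => //.
    exact: differentiable_exp_coord.
  rewrite deriveMl; last exact/diff_derivable/differentiable_exp_coord.
  by congr (_ + _ * _); [exact: pv | exact: partial_exp_coord].
have dE k : differentiable (fun y => k * E y) x0.
  by apply: differentiableM => //; exact: differentiable_exp_coord.
have ddw i : differentiable (dw i) x0.
  by apply: differentiableD; [exact: ddv | apply: differentiableM].
have pdw i j : partial j (dw i) x0 = partial j (dv i) x0
    + e * (g * (i == i0)%:R * (g * (j == i0)%:R * E x0)).
  rewrite {1}/partial deriveD; last 2 first.
  - exact/diff_derivable/ddv.
  - by apply: diff_derivable; apply: differentiableM.
  rewrite !deriveMl; last 2 first.
  - exact/diff_derivable/differentiable_exp_coord.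
  - exact: diff_derivable.
  by congr (_ + _ * (_ * _)); exact: partial_exp_coord.
have [||| Dw Hw] := @local_max_hessian R n w dw x0.
- by apply: filterS nU => y Uy; split=> [|i]; [exact: diffw | exact: wdw].
- exact: ddw.
(* [x0] maximises [w] only over [K]; the strict inequality at [x0] makes [K] a neighbourhood of it,
   so the maximum is local. *)
- have : \forall y \near x0, c' < v y.
    have /cvgrPdist_lt := differentiable_continuous (diffv _ Ux0).
    move=> /(_ (v x0 - c')); rewrite subr_gt0 => /(_ vx0).
    apply: filterS => y; rewrite ltr_distlC => /andP[+ _]; lra.
  move=> c'v; apply: filterS2 nU c'v => y Uy vy; apply/wmax/mem_set; split.
    exact: subset_closure.
  by rewrite /= phiv // ltW.
have Hpsd : psd (- (\matrix_(i, j) partial j (dw i) x0)).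
  move=> y; rewrite mulmxN mulNmx mxE oppr_ge0 formE.
  by under eq_bigr do under eq_bigr do rewrite mxE; exact: Hw.
have := psd_trace_le0 (asym _ Ux0) (apsd _ Ux0) Hpsd.
under eq_bigr do under eq_bigr do rewrite mxE pdw mulrDr.
under eq_bigr do rewrite big_split.
rewrite big_split /= leNgt => /negP; apply.
have := Lv _ Ux0.
(* Since the gradient of [w] vanishes at [x0], that of [v] is minus that of [e * E]. The first-order
   terms thus become the part of the barrier that [g * a] was chosen to beat. *)
have -> : \sum_i b i x0 * dv i x0 = - (e * g * E x0 * b i0 x0).
  rewrite (bigD1 i0) //= big1 ?addr0 => [|i ii0].
    have := Dw i0; rewrite /dw eqxx mulr1 => /eqP.
    by rewrite addr_eq0 => /eqP ->; ring.
  have := Dw i; rewrite /dw (negPf ii0) mulr0 mul0r mulr0 addr0 => ->.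
  by rewrite mulr0.
have -> : \sum_i \sum_j a x0 i j *
    (e * (g * (i == i0)%:R * (g * (j == i0)%:R * E x0))) =
    e * g * E x0 * (g * a x0 i0 i0).
  rewrite (bigD1 i0) //= [X in _ + X]big1 ?addr0 => [|i ii0]; last first.
    by rewrite big1 // => j _; rewrite (negPf ii0) !(mulr0, mul0r).
  rewrite (bigD1 i0) //= big1 ?addr0 => [|j ji0]; last first.
    by rewrite (negPf ji0) !(mulr0, mul0r).
  by rewrite !eqxx !mulr1; ring.
rewrite subr_ge0 => H; apply: lt_le_trans (lerD H (lexx _)).
by rewrite -mulrDr mulr_gt0 ?gP // mulr_gt0 // mulr_gt0.
Qed.

(** * Weighted mean curvature of a graph *)

Section WeightedForms.
Context {R : realType} {n : nat}.

Lemma dotE (u v : 'rV[R]_n) : dot u v = (u *m v^T) 0 0.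
Proof. by rewrite mxE; apply: eq_bigr => i _; rewrite mxE. Qed.

Lemma dot_ge0 (u : 'rV[R]_n) : 0 <= dot u u.
Proof. by apply: sumr_ge0 => i _; rewrite -expr2 sqr_ge0. Qed.

Lemma enorm_sqr (u : 'rV[R]_n) : enorm u ^+ 2 = dot u u.
Proof. by rewrite sqr_sqrtr // dot_ge0. Qed.

Definition metric (p : 'rV[R]_n) : 'M[R]_n := 1%:M + p^T *m p.

(** Sherman-Morrison: the inverse is [1 - p^T p / (1 + |p|^2)]. *)
Lemma metric_unit (p : 'rV[R]_n) : metric p \in unitmx.
Proof.
pose w := 1 + dot p p.
have w0 : w != 0 by rewrite gt_eqF // ltr_pwDl // dot_ge0.
have ppp : p^T *m p *m (p^T *m p) = dot p p *: (p^T *m p).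
  rewrite mulmxA -[p^T *m p *m p^T]mulmxA [p *m p^T]mx11_scalar -dotE.
  by rewrite mul_mx_scalar -scalemxAl.
suff /mulmx1_unit[] : metric p *m (1%:M - w^-1 *: (p^T *m p)) = 1%:M by [].
rewrite /metric mulmxDl mul1mx mulmxBr mulmx1 -scalemxAr ppp scalerA.
have -> : dot p p = w - 1 by rewrite /w; ring.
by move: (p^T *m p) => M; apply/matrixP => i j; rewrite !mxE; field.
Qed.

(** The rows of [(1 | p^T)] are the tangent vectors of the graph. Modulo multiples of
    [q = (- p, 1)], which [A] annihilates on both sides, this frame equals [metric p *m (1 | 0)],
    and [(1 | 0)] extracts the upper left block. *)
Lemma weighted_form_graph (A : 'M[R]_(n + 1)) (p : 'rV[R]_n) :
  A^T = A -> pt (- p) 1 *m A = 0 ->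
  row_mx 1%:M p^T *m A *m (row_mx 1%:M p^T)^T = metric p *m ulsubmx A *m metric p.
Proof.
move=> As qA; pose J : 'M[R]_(n, n + 1) := row_mx 1%:M 0.
have PE : row_mx 1%:M p^T = metric p *m J + p^T *m pt (- p) 1 :> 'M[R]_(n, n + 1).
  rewrite /J /pt !mul_mx_row mulmx1 mulmx0 add_row_mx mulmxN addrK add0r.
  by congr row_mx; apply/matrixP => i j; rewrite !mxE big_ord1 !mxE mulr1 ord1.
have gT : (metric p)^T = metric p.
  by rewrite /metric linearD /= trmx1 trmx_mul trmxK.
have Aq : A *m (pt (- p) 1)^T = 0 by rewrite -As -trmx_mul qA trmx0.
have JAJ : J *m A *m J^T = ulsubmx A.
  rewrite -[A in LHS]submxK mul_row_block tr_row_mx mul_row_col.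
  by rewrite !mul0mx !mul1mx trmx0 trmx1 mulmx0 !addr0 mulmx1.
rewrite PE mulmxDl -[p^T *m _ *m A]mulmxA qA mulmx0 addr0.
rewrite linearD /= mulmxDr [(p^T *m _)^T]trmx_mul -[_ *m A *m (_ *m _)]mulmxA.
rewrite [A *m (_ *m _)]mulmxA Aq mul0mx mulmx0 addr0.
by rewrite trmx_mul gT -JAJ !mulmxA.
Qed.

End WeightedForms.

Lemma pt_lshift (R : realType) (n : nat) (p : 'rV[R]_n) (z : R) (i : 'I_1) (k : 'I_n) :
  pt p z i (lshift 1 k) = p i k.
Proof. exact: row_mxEl. Qed.

Lemma pt_rshift (R : realType) (n : nat) (p : 'rV[R]_n) (z : R) (i k : 'I_1) :
  pt p z i (rshift n k) = z.
Proof. by rewrite /pt row_mxEr mxE. Qed.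

Lemma derivable_pt (R : realType) (V : normedModType R) (n : nat)
    (f : V -> 'rV[R]_n) (z : V -> R) (x v : V) :
  derivable f x v -> derivable z x v -> derivable (fun y => pt (f y) (z y)) x v.
Proof.
move=> /derivable_mxP fd zd; apply/derivable_mxP => i j.
case: (split_ordP j) => k ->.
  by under eq_fun do rewrite pt_lshift; exact: fd.
by under eq_fun do rewrite pt_rshift; exact: zd.
Qed.

Lemma derive_pt (R : realType) (V : normedModType R) (n : nat)
    (f : V -> 'rV[R]_n) (z : V -> R) (x v : V) :
  derivable f x v -> derivable z x v ->
  'D_v (fun y => pt (f y) (z y)) x = pt ('D_v f x) ('D_v z x).
Proof.
move=> fd zd; rewrite derive_mx; last exact: derivable_pt.
apply/rowP => j; rewrite mxE; case: (split_ordP j) => k ->.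
  under eq_fun do rewrite pt_lshift.
  by rewrite pt_lshift derive_mx // mxE.
under eq_fun do rewrite pt_rshift.
by rewrite pt_rshift.
Qed.

Lemma dot_pt (R : realType) (n : nat) (a b : 'rV[R]_n) (s t : R) :
  dot (pt a s) (pt b t) = dot a b + s * t.
Proof.
rewrite /dot big_split_ord big_ord1 /= !pt_rshift; congr (_ + _).
by apply: eq_bigr => i _; rewrite !pt_lshift.
Qed.

Lemma dotZr (R : realType) (n : nat) (a b : 'rV[R]_n) (c : R) :
  dot a (c *: b) = c * dot a b.
Proof. by rewrite mulr_sumr; apply: eq_bigr => i _; rewrite mxE; ring. Qed.

Lemma row_form (R : realType) (m n : nat) (P : 'M[R]_(n, m)) (A : 'M[R]_m) i j :
  (row i P *m A *m (row j P)^T) 0 0 = (P *m A *m P^T) i j.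
Proof.
by rewrite -row_mul [LHS]mxE [RHS]mxE; apply: eq_bigr => k _; rewrite !mxE.
Qed.

Section GraphCurvature.
Context {R : realType} {n : nat}.
Variables (U : set 'rV[R]_n) (u : 'rV[R]_n -> R) (x : 'rV[R]_n).
Hypotheses (oU : open U) (uC : Ck 2 U u) (Ux : U x).

Lemma partial_graph_map i y : U y ->
  partial i (graph_map u) y = pt (bvec R i) (partial i u y).
Proof.
move=> Uy; have [_ /(_ i) [ud _]] := uC.
by rewrite /partial (derive_pt (@derivable_id _ _ y _) (ud y Uy)) derive_id.
Qed.

Lemma partial2_graph_map i j :
  partial i (partial j (graph_map u)) x = pt 0 (partial i (partial j u) x).
Proof.
rewrite {1}/partial (@near_eq_derive _ _ _ _ (fun y => pt (bvec R j) (partial j u y))).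
  rewrite derive_pt ?derive_cst //.
  by have [_ /(_ j) [_ [_ /(_ i) [+ _]]]] := uC; apply.
have nU : \forall y \near x, U y by exact: open_nbhs_nbhs.
by apply: filterS nU => y; exact: partial_graph_map.
Qed.

(** Homogeneity gives [G (N) = W *: G (q)], while the second form is [W^-1] times the Hessian, so
    the powers of [W] cancel. The two metric factors around the block cancel against the two
    inverses of the first form. *)
Lemma wmc_graph (G : 'rV[R]_(n + 1) -> 'M[R]_(n + 1)) : weight_matrix G ->
  weighted_mean_curvature G (graph_map u) (upper_normal u) x =
  \tr (ulsubmx (G (pt (- grad u x) 1)) *m \matrix_(i, j) partial i (partial j u) x).
Proof.
move=> [Gs _ Gh G0]; set q := pt _ 1; set p := grad u x in q *.
set W := Num.sqrt (1 + enorm p ^+ 2).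
have W0 : 0 < W by rewrite sqrtr_gt0 ltr_pwDl // sqr_ge0.
have q0 : q != 0.
  apply/eqP => /rowP /(_ (rshift n ord0)); rewrite row_mxEr !mxE => /eqP.
  by rewrite oner_eq0.
have GN : G (W^-1 *: q) = W *: G q.
  by rewrite -(Gh q W^-1) ?invr_gt0 // scalerA mulfV ?scale1r // gt_eqF.
pose P : 'M[R]_(n, n + 1) := row_mx 1%:M p^T.
have XE i : partial i (graph_map u) x = row i P.
  rewrite partial_graph_map // /P row_row_mx row1 /pt.
  by congr row_mx; apply/rowP => k; rewrite !mxE.
have PP : P *m P^T = metric p.
  by rewrite /P tr_row_mx mul_row_col trmx1 mulmx1 trmxK.
have qG : q *m G q = 0.
  by have /(congr1 trmx) := G0 q q0; rewrite /mxapp trmxK trmx0 => /(congr1 trmx);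
     rewrite trmx_mul trmxK Gs // trmx0.
have F1 : first_form (graph_map u) x = metric p.
  by apply/matrixP => i j; rewrite mxE !XE dotE -PP -[row i P]mulmx1 row_form mulmx1.
have F2 : second_form (graph_map u) (upper_normal u) x =
    W^-1 *: \matrix_(i, j) partial i (partial j u) x.
  apply/matrixP => i j; rewrite !mxE partial2_graph_map dotZr dot_pt mulr1.
  by rewrite /dot big1 ?add0r // => k _; rewrite mxE mul0r.
have F3 : weighted_form G (graph_map u) (upper_normal u) x =
    W *: (metric p *m ulsubmx (G q) *m metric p).
  rewrite -weighted_form_graph ?Gs // scalemxAl scalemxAr -GN.
  apply/matrixP => i j; rewrite mxE !XE dotE /mxapp trmx_mul trmxK -row_form.
  by rewrite Gs // scaler_eq0 negb_or q0 invr_eq0 gt_eqF.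
rewrite /weighted_mean_curvature /shape_matrix F1 F2 F3.
rewrite -!scalemxAr -scalemxAl scalerA mulVf ?gt_eqF // scale1r.
by rewrite !mulmxA mulVmx ?metric_unit // mul1mx mulmxK ?metric_unit.
Qed.

End GraphCurvature.

(** * Cauchy-Schwarz inequality and positivity of the weight *)

Lemma dot_cauchy_schwarz (R : realType) (n : nat) (a b : 'rV[R]_n) :
  `|dot a b| <= enorm a * enorm b.
Proof.
have dotZ2 (s t : R) : 0 <= s ^+ 2 * dot a a + 2 * s * t * dot a b + t ^+ 2 * dot b b.
  have := dot_ge0 (s *: a + t *: b); congr (0 <= _).
  rewrite /dot !mulr_sumr -!big_split /=; apply: eq_bigr => i _.
  by rewrite !mxE; ring.
rewrite -(ger0_norm (mulr_ge0 (sqrtr_ge0 _) (sqrtr_ge0 _))) -ler_sqr ?nnegrE //.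
rewrite !real_normK ?num_real // exprMn !enorm_sqr.
have := dot_ge0 a; have := dot_ge0 b.
set X := dot a a in dotZ2 *; set Y := dot b b in dotZ2 *; set Z := dot a b in dotZ2 *.
rewrite le_eqVlt => /orP[/eqP Y0|Y0] X0.
  have Z0 : Z = 0.
    (* For [Y = 0] the quadratic is affine in [t]; this value of [t] would make it equal to -1. *)
    apply/eqP; apply: contraT => Z0; have := dotZ2 1 (- (X + 1) / (2 * Z)).
    rewrite -Y0 (_ : _ + _ = -1); last by field.
    by rewrite oppr_ge0 ler10.
  by rewrite Z0 expr0n mulr_ge0 // -Y0.
(* The minimiser [t / s = - Z / Y], scaled by [Y] to avoid a quotient. *)
have := dotZ2 Y (- Z); rewrite (_ : _ + _ = Y * (X * Y - Z ^+ 2)); last by ring.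
by rewrite pmulr_rge0 // subr_ge0.
Qed.

Lemma dotBZl (R : realType) (n : nat) (a b d : 'rV[R]_n) (c : R) :
  dot (a - c *: b) d = dot a d - c * dot b d.
Proof.
rewrite /dot mulr_sumr -sumrB; apply: eq_bigr => i _.
by rewrite !mxE mulrBl mulrA.
Qed.

Section WeightPositivity.
Context {R : realType} {m : nat}.
Variables (G : 'rV[R]_m -> 'M[R]_m).
Hypothesis hG : weight_matrix G.

(** As [G (p)] is symmetric and annihilates [p], its form sees only the projection of [z] onto the
    orthogonal complement of [p], where positivity is assumed. *)
Lemma weight_form (p z : 'rV[R]_m) : p != 0 ->
  (z *m G p *m z^T) 0 0 =
  dot (mxapp (G p) (z - (dot z p / dot p p) *: p)) (z - (dot z p / dot p p) *: p).
Proof.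
move=> p0; have [Gs _ _ G0] := hG.
have Gp : G p *m p^T = 0.
  by have := G0 p p0; rewrite /mxapp => /(congr1 trmx); rewrite trmxK trmx0.
set t := dot z p / _; rewrite -scaleNr dotE /mxapp trmx_mul trmxK Gs //.
by rewrite formDZ ?Gs // -!mulmxA Gp !mulmx0 !mxE !mulr0 !addr0.
Qed.

Lemma dot_gt0 (p : 'rV[R]_m) : p != 0 -> 0 < dot p p.
Proof.
move=> p0; rewrite lt_neqAle dot_ge0 andbT eq_sym; apply: contra p0.
rewrite psumr_eq0 => [/allP p0|i _]; last by rewrite -expr2 sqr_ge0.
apply/eqP/rowP => i; rewrite mxE.
by have /eqP := p0 i (mem_index_enum _); rewrite -expr2 => /eqP; rewrite sqrf_eq0 => /eqP.
Qed.

Lemma weight_form_gt0 (p z : 'rV[R]_m) :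
  p != 0 -> (forall t, z != t *: p) -> 0 < (z *m G p *m z^T) 0 0.
Proof.
move=> p0 zp; rewrite weight_form //; have [_ Gpos _ _] := hG.
apply: Gpos => //; first by rewrite subr_eq0.
by rewrite dotBZl divfK ?subrr // gt_eqF // dot_gt0.
Qed.

Lemma weight_psd (p : 'rV[R]_m) : p != 0 -> psd (G p).
Proof.
move=> p0 z; have [[t ->]|zp] := pselect (exists t, z = t *: p).
  rewrite weight_form // (_ : _ - _ = 0).
    by rewrite dotE trmx0 mulmx0 mxE.
  rewrite -scalerBl (_ : dot (t *: p) p = t * dot p p).
    by rewrite mulfK ?subrr ?scale0r // gt_eqF // dot_gt0.
  by rewrite !dotE -scalemxAl mxE.
apply/ltW/weight_form_gt0 => // t; apply/eqP => E; apply: zp; by exists t.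
Qed.

End WeightPositivity.

Section UpperLeftBlock.
Context {R : realType} {n : nat}.
Variables (G : 'rV[R]_(n + 1) -> 'M[R]_(n + 1)) (q : 'rV[R]_(n + 1)).
Hypotheses (hG : weight_matrix G) (q1 : q 0 (rshift n ord0) = 1).

Let q0 : q != 0.
Proof. by apply/eqP => /rowP/(_ (rshift n ord0)) /eqP; rewrite q1 mxE oner_eq0. Qed.

Lemma ulsubmx_form (y : 'rV[R]_n) :
  (y *m ulsubmx (G q) *m y^T) 0 0 = (row_mx y 0 *m G q *m (row_mx y (0 : 'M[R]_1))^T) 0 0.
Proof.
rewrite -[G q in RHS]submxK mul_row_block tr_row_mx mul_row_col.
by rewrite !mul0mx trmx0 mulmx0 !addr0.
Qed.

Lemma ulsubmx_weight_psd : psd (ulsubmx (G q)).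
Proof. by move=> y; rewrite ulsubmx_form; exact: weight_psd. Qed.

Lemma ulsubmx_weight_sym : (ulsubmx (G q))^T = ulsubmx (G q).
Proof. by have [Gs _ _ _] := hG; rewrite trmx_ulsub Gs. Qed.

(** The entry is the form of [G q] at the horizontal vector [(e_i, 0)]. This is not a multiple of
    [q]: comparing last coordinates forces the factor to be 0. *)
Lemma ulsubmx_weight_gt0 i : 0 < ulsubmx (G q) i i.
Proof.
rewrite -form_delta ulsubmx_form; apply: weight_form_gt0 => // t.
apply/eqP => /rowP E; have := E (rshift n ord0).
rewrite row_mxEr !mxE q1 mulr1 => t0; have := E (lshift 1 i).
by rewrite row_mxEl !mxE -t0 mul0r !eqxx => /eqP; rewrite oner_eq0.
Qed.

Lemma ulsubmx_weight_tr_gt0 (i : 'I_n) : 0 < \tr (ulsubmx (G q)).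
Proof.
rewrite /mxtrace (bigD1 i) //= ltr_pwDl ?ulsubmx_weight_gt0 //.
by apply: sumr_ge0 => j _; exact/ltW/ulsubmx_weight_gt0.
Qed.

Lemma ulsubmx_weight_tr_le : \tr (ulsubmx (G q)) <= \tr (G q).
Proof.
rewrite /mxtrace big_split_ord /= big_ord1.
rewrite (eq_bigr (fun i => G q (lshift 1 i) (lshift 1 i))); last first.
  by move=> i _; rewrite !mxE.
by rewrite lerDl psd_diag_ge0 //; exact: weight_psd.
Qed.

End UpperLeftBlock.

(** * Chain rule and entries of matrix-valued maps *)

Section ChainRule.
Context {R : realType}.

Lemma differentiable_row (V : normedModType R) (m : nat) (f : V -> 'rV[R]_m) (x : V) :
  (forall j, differentiable (fun y => f y 0 j) x) -> differentiable f x.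
Proof.
move=> fd; rewrite (_ : f = \sum_j (fun y => f y 0 j *: bvec R j)).
  by apply: differentiable_sum => j; exact: differentiableZl.
by apply/funext => y; rewrite fct_sumE {1}(row_sum_bvec (f y)).
Qed.

Lemma derive_comp_partial (n m : nat) (f : 'rV[R]_n -> 'rV[R]_m)
    (g : 'rV[R]_m -> R) (x v : 'rV[R]_n) :
  differentiable f x -> differentiable g (f x) ->
  'D_v (g \o f) x = \sum_l ('D_v f x) 0 l * partial l g (f x).
Proof.
move=> fd gd; rewrite deriveE; last exact: differentiable_comp.
by rewrite diff_comp //= -deriveE // diff_partialE // deriveE.
Qed.

Lemma differentiable_pt (n : nat) (V : normedModType R) (f : V -> 'rV[R]_n)
    (z : V -> R) (x : V) :
  differentiable f x -> differentiable z x -> differentiable (fun y => pt (f y) (z y)) x.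
Proof.
move=> fd zd; apply: differentiable_row => j; case: (split_ordP j) => k ->.
  under eq_fun do rewrite pt_lshift.
  exact: (differentiable_comp fd (differentiable_coord _ _ _)).
by under eq_fun do rewrite pt_rshift.
Qed.

Lemma C1_entry (n m p : nat) (U : set 'rV[R]_n) (G : 'rV[R]_n -> 'M[R]_(m, p)) i j :
  open U -> Ck 1 U G -> Ck 1 U (fun x => G x i j).
Proof.
move=> oU [Gc Gd]; split=> [x Ux|k].
  exact: (cvg_comp _ _ (Gc x Ux) (@coord_continuous _ _ _ i j _)).
have [dG [pG _]] := Gd k.
have E x : U x -> partial k G x i j = partial k (fun y => G y i j) x.
  by move=> Ux; rewrite /partial derive_mx ?mxE //; exact: dG.
split=> [x Ux|]; first by have /derivable_mxP := dG x Ux; apply.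
split=> // x Ux; rewrite /prop_for /continuous_at /= -E //.
apply: (@cvg_trans _ ((fun y => partial k G y i j) @ x)).
  have nE : \forall y \near x, partial k G y i j = partial k (fun y => G y i j) y.
    by apply: filterS (open_nbhs_nbhs (conj oU Ux)) => y; exact: E.
  exact: near_eq_cvg nE.
exact: (cvg_comp _ _ (pG x Ux) (@coord_continuous _ _ _ i j _)).
Qed.

End ChainRule.

(** * The equation satisfied by the squared gradient *)

Lemma CkW (R : realType) (n : nat) (V : normedModType R) (k : nat)
    (U : set 'rV[R]_n) (f : 'rV[R]_n -> V) : Ck k.+1 U f -> Ck k U f.
Proof.
elim: k f => [|k IH] f [fc fd]; split=> // i.
by have [? ?] := fd i; split=> //; exact: IH.
Qed.

Lemma open_cylinder (R : realType) (n : nat) (U : set 'rV[R]_n) :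
  open U -> open (cylinder U).
Proof. by move=> oU; apply: open_comp => // q _; exact: continuous_lsubmx. Qed.

Lemma open_neq0 (R : realType) (n : nat) : open [set p : 'rV[R]_n | p != 0].
Proof.
rewrite (_ : [set _ | _] = ~` [set 0]).
  by apply/closed_openC/accessible_closed_set1/hausdorff_accessible/norm_hausdorff.
by apply/seteqP; split => p /= /eqP.
Qed.

(** The finite-sum algebra of the contraction, kept free of calculus. In the application [c] is
    [grad u], [S] and [T] hold its second and third derivatives, [h] is the derivative of the
    right-hand side, and [A i j] is the part of [v_ij] quadratic in [D^2 u]. *)
Lemma contract_equations (R : comNzRingType) (n : nat) (c h b : 'I_n -> R)
    (a A : 'I_n -> 'I_n -> R) (T : 'I_n -> 'I_n -> 'I_n -> R) (S : 'I_n -> 'I_n -> R) :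
  (forall k, \sum_i \sum_j a i j * T k i j + \sum_l b l * S k l = h k) ->
  \sum_i \sum_j a i j * (\sum_k c k * T k i j + A i j)
    + \sum_l b l * (\sum_k c k * S k l)
  = \sum_i \sum_j a i j * A i j + \sum_k c k * h k.
Proof.
move=> E; have -> : \sum_k c k * h k =
    \sum_i \sum_j a i j * (\sum_k c k * T k i j) + \sum_l b l * (\sum_k c k * S k l).
  under eq_bigr => k _ do rewrite -E mulrDr.
  rewrite big_split /=; congr (_ + _).
    under eq_bigr => k _.
      rewrite mulr_sumr; under eq_bigr => i _ do rewrite mulr_sumr; over.
    rewrite exchange_big /=; apply: eq_bigr => i _.
    rewrite exchange_big /=; apply: eq_bigr => j _.
    by rewrite mulr_sumr; apply: eq_bigr => k _; rewrite mulrCA.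
  under eq_bigr => k _ do rewrite mulr_sumr.
  rewrite exchange_big /=; apply: eq_bigr => l _.
  by rewrite mulr_sumr; apply: eq_bigr => k _; rewrite mulrCA.
rewrite addrA; congr (_ + _); rewrite -big_split; apply: eq_bigr => i _ /=.
by rewrite -big_split; apply: eq_bigr => j _ /=; rewrite mulrDr addrC.
Qed.

Section DifferentiatedEquation.
Context {R : realType} {n : nat}.
Variables (G : 'rV[R]_(n + 1) -> 'M[R]_(n + 1)) (H : 'rV[R]_(n + 1) -> R).
Variables (U : set 'rV[R]_n) (u : 'rV[R]_n -> R).
Hypotheses (hG : weight_matrix G) (hG1 : Ck 1 [set p | p != 0] G).
Hypotheses (oU : open U) (hH : Ck 1 (cylinder U) H) (hu3 : Ck 3 U u).
Hypothesis hu : graph_prescribed_wmc G U H u.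

Definition conormal (y : 'rV[R]_n) := pt (- grad u y) 1.

Local Notation d i f := (partial i f).
Local Notation g i j := (fun p => G p (lshift 1 i) (lshift 1 j)).
Local Notation q := conormal.

Definition half_sqr_grad (y : 'rV[R]_n) : R := dot (grad u y) (grad u y) / 2.

(* With [d k (d i u)] instead of [d i (d k u)], differentiating once more only requires
   exchanging the two outermost derivatives. *)
Definition d_half_sqr_grad i (y : 'rV[R]_n) : R :=
  \sum_k d k u y * d k (d i u) y.

(** Coefficient of [u_kl] when the weights in [sum_ij g_ij (q) u_ij] are differentiated in direction
    [k]. The sign comes from [q = (- grad u, 1)]; the last coordinate of [q] is constant, so only
    horizontal derivatives of [G] enter. *)
Definition drift l (y : 'rV[R]_n) : R :=
  - \sum_i \sum_j d j (d i u) y * d (lshift 1 l) (g i j) (q y).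

Let du i : Ck 2 U (d i u). Proof. exact: (hu3.2 i).2. Qed.
Let ddu i j : Ck 1 U (d i (d j u)). Proof. exact: ((du j).2 i).2. Qed.

Let diffdu i y : U y -> differentiable (d i u) y.
Proof. by move=> Uy; exact: (C1_differentiable oU (CkW (du i)) Uy). Qed.

Let diffddu i j y : U y -> differentiable (d i (d j u)) y.
Proof. by move=> Uy; exact: (C1_differentiable oU (ddu i j) Uy). Qed.

Lemma conormal_last y : q y 0 (rshift n ord0) = 1.
Proof. exact: pt_rshift. Qed.

Lemma conormal_neq0 y : q y != 0.
Proof.
by apply/eqP => /rowP/(_ (rshift n ord0)) /eqP; rewrite conormal_last mxE oner_eq0.
Qed.

Lemma differentiable_grad y : U y -> differentiable (grad u) y.
Proof.
move=> Uy; apply: differentiable_row => j.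
by under eq_fun do rewrite mxE; exact: diffdu.
Qed.

Lemma differentiable_conormal y : U y -> differentiable q y.
Proof.
move=> Uy; apply: differentiable_pt => //.
by apply: differentiableN; exact: differentiable_grad.
Qed.

Lemma partial_conormal k y : U y -> d k q y = pt (- \row_l d k (d l u) y) 0.
Proof.
move=> Uy; have dg := diff_derivable (v := bvec R k) (differentiable_grad Uy).
have gE l : (fun z => grad u z 0 l) = d l u by apply/funext => z; rewrite mxE.
have dgE : 'D_(bvec R k) (fun z => - grad u z) y = - \row_l d k (d l u) y.
  apply: etrans (deriveN dg) _; congr (- _).
  by rewrite (derive_mx dg); apply/rowP => l; rewrite [LHS]mxE [RHS]mxE gE.
have dN : derivable (fun z => - grad u z) y (bvec R k) by exact: derivableN dg.
by rewrite -dgE -(derive_cst (1 : R) y (bvec R k)) -(derive_pt dN (derivable_cst _ _ _)).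
Qed.

Lemma C1_weight_entry i j : Ck 1 [set p | p != 0] (g i j).
Proof. exact: C1_entry (@open_neq0 R (n + 1)) hG1. Qed.

Lemma differentiable_weight_entry i j y : differentiable (g i j) (q y).
Proof.
exact: (C1_differentiable (@open_neq0 R (n + 1)) (C1_weight_entry i j) (conormal_neq0 y)).
Qed.

Lemma equation_expanded y : U y ->
  \sum_i \sum_j g i j (q y) * d j (d i u) y = H (pt y (u y)).
Proof.
move=> Uy; rewrite -hu // (wmc_graph oU (CkW hu3) Uy hG).
rewrite /mxtrace; apply: eq_bigr => i _; rewrite mxE; apply: eq_bigr => j _.
by rewrite !mxE.
Qed.

Lemma partial_weight_entry k i j y : U y ->
  d k (g i j \o q) y = - \sum_l d k (d l u) y * d (lshift 1 l) (g i j) (q y).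
Proof.
move=> Uy; rewrite /partial derive_comp_partial; last 2 first.
- exact: differentiable_conormal.
- exact: differentiable_weight_entry.
rewrite -/(partial k q y) partial_conormal // big_split_ord big_ord1 /=.
rewrite pt_rshift mul0r addr0 -sumrN; apply: eq_bigr => l _.
by rewrite pt_lshift !mxE mulNr.
Qed.

Lemma differentiated_equation k y : U y ->
  \sum_i \sum_j g i j (q y) * d k (d j (d i u)) y + \sum_l drift l y * d k (d l u) y
  = d (lshift 1 k) H (pt y (u y)) + d k u y * d (rshift n ord0) H (pt y (u y)).
Proof.
move=> Uy.
pose F := \sum_i \sum_j (g i j \o q) * d j (d i u).
have dgq i j : differentiable (g i j \o q) y.
  exact: differentiable_comp (differentiable_conormal Uy) (differentiable_weight_entry i j y).
(* The equation holds on an open set, so its two sides have the same derivative at [y]. *)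
have FE : \forall z \near y, F z = (H \o (fun z => pt z (u z))) z.
  apply: filterS (open_nbhs_nbhs (conj oU Uy)) => z Uz.
  rewrite /= -equation_expanded // /F fct_sumE; apply: eq_bigr => i _.
  by rewrite fct_sumE.
have := near_eq_derive (bvec R k) FE.
rewrite derive_comp_partial; last 2 first.
- by apply: differentiable_pt => //; exact: (C1_differentiable oU (CkW (CkW hu3)) Uy).
- by apply: (C1_differentiable (open_cylinder oU) hH); rewrite /cylinder /= row_mxKl.
have -> : 'D_(bvec R k) (fun z => pt z (u z)) y = pt (bvec R k) (d k u y).
  by rewrite -(partial_graph_map (CkW hu3) k Uy).
rewrite big_split_ord big_ord1 /= pt_rshift.
rewrite (bigD1 k) //= big1 ?addr0 => [|l lk]; last first.
  by rewrite pt_lshift mxE (negPf lk) andbF mul0r.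
rewrite pt_lshift mxE !eqxx mul1r => <-.
rewrite derive_sum => [|i]; last first.
  by apply: derivable_sum => j; apply/diff_derivable/differentiableM => //; exact: diffddu.
under [RHS]eq_bigr => i _.
  rewrite derive_sum => [|j]; last first.
    by apply/diff_derivable/differentiableM => //; exact: diffddu.
  under eq_bigr => j _.
    rewrite deriveM; last 2 first.
    - exact/diff_derivable/dgq.
    - exact/diff_derivable/diffddu.
    rewrite -/(partial k (g i j \o q) y) partial_weight_entry //.
    over.
  rewrite big_split; over.
rewrite big_split /=; congr (_ + _).
(* The rest is a reindexing: the sum over [l] from the chain rule is moved outside to match the
   definition of [drift]. *)
under eq_bigr => l _.
  rewrite /drift mulNr mulr_suml -sumrN.
  under eq_bigr => i _ do rewrite mulr_suml -sumrN.
  over.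
rewrite exchange_big /=; apply: eq_bigr => i _.
rewrite exchange_big /=; apply: eq_bigr => j _.
rewrite /GRing.scale /= mulrN mulr_sumr -sumrN; apply: eq_bigr => l _.
by rewrite mulrAC -mulrA.
Qed.

Lemma half_sqr_gradE : half_sqr_grad = 2^-1 \*: \sum_k (d k u * d k u).
Proof.
apply/funext => z; rewrite /half_sqr_grad mulrC; congr (_ * _); rewrite fct_sumE.
by apply: eq_bigr => k _; rewrite !mxE.
Qed.

Lemma d_half_sqr_gradE i : d_half_sqr_grad i = \sum_k (d k u * d k (d i u)).
Proof. by apply/funext => z; rewrite fct_sumE. Qed.

Lemma partial_half_sqr_grad i y : U y -> d i half_sqr_grad y = d_half_sqr_grad i y.
Proof.
move=> Uy; rewrite half_sqr_gradE.
have dk k : derivable (d k u) y (bvec R i) by exact/diff_derivable/diffdu.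
have dC k : 'D_(bvec R i) (d k u) y = d k (d i u) y by exact: partialC oU (CkW hu3) Uy.
rewrite {1}/partial deriveZ; last by apply: derivable_sum => k; exact: derivableM (dk k) (dk k).
rewrite derive_sum => [|k]; last exact: derivableM (dk k) (dk k).
rewrite /GRing.scale /= mulr_sumr; apply: eq_bigr => k _.
rewrite (deriveM (dk k) (dk k)) dC.
by rewrite /GRing.scale /=; field.
Qed.

Lemma differentiable_half_sqr_grad y : U y -> differentiable half_sqr_grad y.
Proof.
move=> Uy; rewrite half_sqr_gradE.
apply: differentiableZ; apply: differentiable_sum => k.
by apply: differentiableM; exact: diffdu.
Qed.

Lemma differentiable_d_half_sqr_grad i y : U y -> differentiable (d_half_sqr_grad i) y.
Proof.
move=> Uy; rewrite d_half_sqr_gradE; apply: differentiable_sum => k.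
by apply: differentiableM; [exact: diffdu | exact: diffddu].
Qed.

Lemma partial_d_half_sqr_grad i j y : U y -> d j (d_half_sqr_grad i) y =
  \sum_k d k u y * d k (d j (d i u)) y + \sum_k d k (d i u) y * d j (d k u) y.
Proof.
move=> Uy; rewrite d_half_sqr_gradE.
have d1 k : derivable (d k u) y (bvec R j) by exact/diff_derivable/diffdu.
have d2 k : derivable (d k (d i u)) y (bvec R j) by exact/diff_derivable/diffddu.
have dC k : 'D_(bvec R j) (d k (d i u)) y = d k (d j (d i u)) y.
  exact: partialC oU (du i) Uy.
rewrite {1}/partial derive_sum => [|k]; last exact: derivableM (d1 k) (d2 k).
rewrite -big_split /=; apply: eq_bigr => k _.
apply: etrans (deriveM (d1 k) (d2 k)) _.
exact: (congr1 (fun r => d k u y * r + _) (dC k)).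
Qed.

Lemma linearized_half_sqr_grad y : U y ->
  \sum_i \sum_j g i j (q y) * d j (d_half_sqr_grad i) y
    + \sum_l drift l y * d_half_sqr_grad l y
  = \sum_i \sum_j g i j (q y) * (\sum_k d k (d i u) y * d j (d k u) y)
    + \sum_k d k u y * (d (lshift 1 k) H (pt y (u y))
        + d k u y * d (rshift n ord0) H (pt y (u y))).
Proof.
move=> Uy.
apply: etrans (contract_equations (fun k => d k u y) _
  (fun k => differentiated_equation k Uy)).
apply: (congr1 (fun r => r + _)); apply: eq_bigr => i _; apply: eq_bigr => j _.
exact: congr1 (partial_d_half_sqr_grad i j Uy).
Qed.

Lemma half_sqr_grad_subsolution (i0 : 'I_n) y : U y ->
  0 <= d (rshift n ord0) H (pt y (u y)) ->
  (forall p, enorm p = 1 -> \tr (G p) * enorm (grad H (pt y (u y))) <= H (pt y (u y)) ^+ 2) ->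
  0 <= \sum_i \sum_j g i j (q y) * d j (d_half_sqr_grad i) y
    + \sum_l drift l y * d_half_sqr_grad l y.
Proof.
move=> Uy Hz Hsq; rewrite linearized_half_sqr_grad //.
set h := grad H _ in Hsq; set A := ulsubmx (G (q y)).
pose S := \matrix_(i, j) d i (d j u) y.
have Ss : S^T = S by apply/matrixP => i j; rewrite !mxE (partialC _ _ oU (CkW hu3) Uy).
have Ap : psd A := ulsubmx_weight_psd hG (conormal_last y).
have tA : 0 < \tr A := ulsubmx_weight_tr_gt0 hG (conormal_last y) i0.
have tAG : \tr A <= \tr (G (q y)) := ulsubmx_weight_tr_le hG (conormal_last y).
have -> : \sum_i \sum_j g i j (q y) * (\sum_k d k (d i u) y * d j (d k u) y)
    = \tr (S *m A *m S).
  rewrite -mulmxA mxtrace_mulC -mulmxA /mxtrace; apply: eq_bigr => i _.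
  rewrite mxE; apply: eq_bigr => j _; rewrite !mxE; congr (_ * _).
  by apply: eq_bigr => k _; rewrite [RHS]mulrC !mxE.
have HE : H (pt y (u y)) = \tr (A *m S).
  rewrite -equation_expanded // /mxtrace; apply: eq_bigr => i _; rewrite mxE.
  by apply: eq_bigr => j _; rewrite !mxE.
have CS := psd_trace_sqr_le Ap Ss tA; rewrite -HE in CS.
pose p := grad u y; pose W := Num.sqrt (1 + enorm p ^+ 2).
have W0 : 0 < W by rewrite sqrtr_gt0 ltr_pwDl // sqr_ge0.
have WW : W ^+ 2 = 1 + dot p p by rewrite sqr_sqrtr enorm_sqr // addr_ge0 // dot_ge0.
have qW : enorm (W^-1 *: q y) = 1.
  rewrite /enorm (_ : dot _ _ = 1) ?sqrtr1 //.
  have -> : dot (W^-1 *: q y) (W^-1 *: q y) = W^-2 * dot (q y) (q y).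
    by rewrite /dot mulr_sumr; apply: eq_bigr => i _; rewrite !mxE; field; rewrite gt_eqF.
  rewrite dot_pt mulr1 -/p (_ : dot _ _ = dot p p).
    by rewrite addrC -WW mulVf // sqrf_eq0 gt_eqF.
  by apply: eq_bigr => i _; rewrite !mxE mulrNN.
have GW : G (W^-1 *: q y) = W *: G (q y).
  have [_ _ Gh _] := hG.
  by rewrite -(Gh (q y) W^-1) ?invr_gt0 ?conormal_neq0 // scalerA mulfV ?scale1r // gt_eqF.
have := Hsq _ qW; rewrite GW linearZ /= -mulrA => Hle.
(* The horizontal part of [grad H] is paired with [(grad u, 0)] and bounded by Cauchy-Schwarz; the
   vertical part is set apart because the sign of [H_z] makes it nonnegative. *)
have -> : \sum_k d k u y * (d (lshift 1 k) H (pt y (u y))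
      + d k u y * d (rshift n ord0) H (pt y (u y)))
    = dot (pt p 0) h + d (rshift n ord0) H (pt y (u y)) * dot p p.
  rewrite /dot big_split_ord big_ord1 /= pt_rshift mul0r addr0 mulr_sumr -big_split /=.
  by apply: eq_bigr => k _; rewrite pt_lshift !mxE; ring.
have := dot_cauchy_schwarz (pt p 0) h; rewrite ler_norml => /andP[+ _].
have pW : enorm (pt p 0) <= W.
  by rewrite /enorm ler_wsqrtr // dot_pt mul0r addr0 -/(enorm p) enorm_sqr lerDr.
have h0 : 0 <= enorm h by exact: sqrtr_ge0.
have pWh : enorm (pt p 0) * enorm h <= W * enorm h by rewrite ler_wpM2r.
have pz : 0 <= d (rshift n ord0) H (pt y (u y)) * dot p p by rewrite mulr_ge0 // dot_ge0.
(* After multiplication by [\tr A] the chain is [\tr A * W * |h| <= \tr (G (N)) * |h| <= H^2 <= \tr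
   A * \tr (S A S)], with [N = q / W]. *)
have : W * enorm h <= \tr (S *m A *m S).
  rewrite -(ler_pM2l tA); apply: le_trans CS; apply: le_trans Hle.
  by rewrite mulrCA ler_pM2l // ler_wpM2r.
lra.
Qed.

End DifferentiatedEquation.

(** * Continuity of the drift and comparison with the boundary *)

Lemma differentiable_dot_diag (R : realType) (n : nat) (p : 'rV[R]_n) :
  differentiable (fun p : 'rV[R]_n => dot p p) p.
Proof.
rewrite (_ : (fun p => _) = \sum_i (fun p : 'rV[R]_n => p 0 i * p 0 i)).
  by apply: differentiable_sum => i; apply: differentiableM; exact: differentiable_coord.
by apply/funext => z; rewrite fct_sumE.
Qed.

(** The second derivatives of [u] are continuous inside [U] only, and so is the drift; this suffices
    on compact subsets of [U]. The weights cause no trouble, since [q] never vanishes. *)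
Lemma continuous_drift (R : realType) (n : nat)
  (G : 'rV[R]_(n + 1) -> 'M[R]_(n + 1)) (U : set 'rV[R]_n) (u : 'rV[R]_n -> R) l y :
  Ck 1 [set p | p != 0] G -> open U -> Ck 3 U u -> U y ->
  {for y, continuous (drift G u l)}.
Proof.
move=> hG1 oU hu3 Uy.
have qc : {for y, continuous (conormal u)}.
  exact/differentiable_continuous/(differentiable_conormal oU hu3).
have csum (f : 'I_n -> 'rV[R]_n -> R) : (forall i, {for y, continuous (f i)}) ->
    {for y, continuous (fun z => \sum_i f i z)}.
  move=> fc; apply: (@cvg_big R^o _ +%R 0 xpredT _ _ (nbhs y)).
    exact: add_continuous.
  by move=> i _; exact: fc.
have cprod i j : {for y, continuous (fun z => partial j (partial i u) z *
    partial (lshift 1 l) (fun p => G p (lshift 1 i) (lshift 1 j)) (conormal u z))}.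
  have [_ /(_ (lshift 1 l)) [_ [gc _]]] := C1_weight_entry hG1 i j.
  exact: (cvgM (((hu3.2 i).2.2 j).2.1 y Uy)
    (cvg_comp _ _ qc (gc _ (conormal_neq0 u y)))).
exact: (cvgN (csum _ (fun i => csum _ (cprod i)))).
Qed.

Theorem corollary1 (R : realType) (n : nat) (hn : (0 < n)%N)
  (G : 'rV[R]_(n + 1) -> 'M[R]_(n + 1))
  (hG : weight_matrix G)
  (hG1 : Ck 1 [set p | p != 0] G)
  (Omega : set 'rV[R]_n)
  (hOmega : bounded_domain Omega)
  (H : 'rV[R]_(n + 1) -> R)
  (hH1 : exists DH, C1_closure (cylinder Omega) H DH)
  (hHz : forall x z, closure Omega x ->
     0 <= partial (rshift n ord0) H (pt x z))
  (hH : forall x z (p : 'rV[R]_(n + 1)), Omega x -> enorm p = 1 ->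
     \tr (G p) * enorm (grad H (pt x z)) <= H (pt x z) ^+ 2)
  (u : 'rV[R]_n -> R) (Du : 'rV[R]_n -> 'rV[R]_n)
  (hu3 : Ck 3 Omega u)
  (hu1 : C1_closure Omega u Du)
  (hu : graph_prescribed_wmc G Omega H u) :
  (ereal_sup [set (enorm (grad u x))%:E | x in Omega]
   <= ereal_sup [set (enorm (Du x))%:E | x in bdry Omega])%E.
Proof.
have [oU _ _ bU] := hOmega; have [DH [HC _ _ _]] := hH1.
have [_ _ Duc DuE] := hu1.
(* [phi] extends [v] continuously to the closure by means of [Du]; [i0] is the direction in which
   the barrier grows. *)
pose i0 := Ordinal hn; pose phi y := dot (Du y) (Du y) / 2.
have phic : {within closure Omega, continuous phi}.
  have sqc : continuous (fun p : 'rV[R]_n => dot p p / 2).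
    move=> p; apply: differentiable_continuous; apply: differentiableM => //.
    exact: differentiable_dot_diag.
  by move=> x; exact: (cvg_comp _ _ (Duc x) (sqc _)).
have max_bdry x1 c : Omega x1 -> c < half_sqr_grad u x1 ->
    exists2 y, bdry Omega y & c < phi y.
  apply: (weak_maximum_principle (i0 := i0) (dv := d_half_sqr_grad u)
    (a := fun y => ulsubmx (G (conormal u y))) (b := drift G u)) => //.
  - by move=> x Ux; rewrite /phi DuE.
  - by move=> x Ux; exact: (differentiable_half_sqr_grad oU hu3).
  - by move=> x i Ux; exact: (partial_half_sqr_grad oU hu3).
  - by move=> x i Ux; exact: (differentiable_d_half_sqr_grad oU hu3).
  - by move=> x Ux; exact: ulsubmx_weight_sym hG (conormal_last u x).
  - by move=> x Ux; exact: ulsubmx_weight_psd hG (conormal_last u x).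
  - by move=> x Ux; exact: ulsubmx_weight_gt0 hG (conormal_last u x) _.
  - move=> x Ux; have -> : (fun y => ulsubmx (G (conormal u y)) i0 i0) =
        (fun p => G p (lshift 1 i0) (lshift 1 i0)) \o conormal u.
      by apply/funext => y; rewrite !mxE.
    apply: differentiable_continuous.
    exact: (differentiable_comp (differentiable_conormal oU hu3 Ux)
      (differentiable_weight_entry u hG1 i0 i0 x)).
  - by move=> x Ux; exact: (continuous_drift (l := i0) hG1 oU hu3 Ux).
  - move=> x Ux.
    have := half_sqr_grad_subsolution hG hG1 oU HC hu3 hu i0 Ux
      (hHz x (u x) (subset_closure Ux)) (fun p => hH x (u x) p Ux).
    by congr (0 <= _ + _); apply: eq_bigr => i _; apply: eq_bigr => j _; rewrite !mxE.
apply: ge_ereal_sup => _ [x1 Ux1 <-]; rewrite leNgt; apply/negP => supl.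
have sup_ge y : bdry Omega y -> ((enorm (Du y))%:E <=
    ereal_sup [set (enorm (Du x))%:E | x in bdry Omega])%E.
  by move=> yb; apply: ereal_sup_ubound; exists y.
(* Any level below [v x1] yields a boundary point, so the boundary is nonempty and its supremum is
   not [-oo]; being exceeded at [x1], it is not [+oo] either. *)
have [|y0 y0b _] := max_bdry x1 (half_sqr_grad u x1 - 1) Ux1; first by rewrite ltrBlDr ltrDl.
move: sup_ge (sup_ge y0 y0b) supl; case: (ereal_sup _) => // r sup_ge.
rewrite lee_fin lte_fin => ry0 rx1.
have r0 : 0 <= r by apply: le_trans ry0; exact: sqrtr_ge0.
(* The level of [v] that corresponds to the gradient length [r]; since [r >= 0], comparing squares
   is comparing lengths. *)
have [|y yb] := max_bdry x1 (r ^+ 2 / 2) Ux1.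
  by rewrite /half_sqr_grad -enorm_sqr ltr_pM2r ?invr_gt0 // ltr_sqr // nnegrE sqrtr_ge0.
rewrite /phi -enorm_sqr ltr_pM2r ?invr_gt0 // ltr_sqr ?nnegrE ?sqrtr_ge0 // ltNge.
by have := sup_ge y yb; rewrite lee_fin => ->.
Qed.
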